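(* Let $(\mathrm{X},\Sigma,\mu)$ be a measure space and $p\in[1,\infty)$. Let $(f_n)$ be a sequence in $\Lambda_p(\mathrm{X})$ and let $f$ be a measurable function. Then $(f_n)$ $\alpha_p$-converges to $f$ if, and only if, both of the following hold: (i) $(f_n)$ converges to $f$ (locally) in measure; (ii) for every $\varepsilon>0$ there exists a measurable set $E_\varepsilon$ with $\mu(E_\varepsilon)<\infty$ such that $$\sup_n\|f_n\chi_{E_\varepsilon^c}\|_{\alpha_p}<\varepsilon.$$ Here ''(locally)'' means that the equivalence holds both with (i) read as convergence in measure and with (i) read as local convergence in measure.
   Context: Measurable functions are real-valued and identified $\mu$-a.e.; $L_0(\mathrm{X})$ denotes the space of such functions and $L_p(\mathrm{X})$ the usual Lebesgue space with norm $\|\cdot\|_p$. $\Lambda_p(\mathrm{X})$ is the set of $f\in L_0(\mathrm{X})$ such that for every $\delta>0$ there exists $E_\delta\in\Sigma$ with $\mu(E_\delta)<\delta$ and $f\chi_{E_\delta^c}\in L_p(\mathrm{X})$. For a measurable function $f$, $\|f\|_{\alpha_p}=\|\min(|f|,1)\|_p$. A sequence of measurable functions $(f_n)$ asymptotically $L_p$-converges ($\alpha_p$-converges) to a measurable function $f$ if there is a sequence of measurable sets $(B_n)$ with $\mu(B_n^c)\to0$ and $\int_{B_n}|f_n-f|^p\,d\mu\to0$ as $n\to\infty$. $(f_n)$ converges in measure to $f$ if $\mu(|f_n-f|>\delta)\to0$ for each $\delta>0$; it converges locally in measure to $f$ if it converges in measure to $f$ on every measurable subset of $\mathrm{X}$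 of finite measure.
   Formalization: ''Local convergence in measure and (ii) imply α_p-convergence'' fails in general (f_n=0, f=1, X a point of infinite measure); it is proved assuming every measurable subset of {f≠0} of infinite measure contains one of finite positive measure. *)

(* Defs.v *)
From HB Require Import structures.
From mathcomp Require Import all_boot all_order all_algebra.
From mathcomp Require Import all_classical all_reals all_analysis.
Set Implicit Arguments.
Unset Strict Implicit.
Unset Printing Implicit Defensive.
Import Order.TTheory GRing.Theory Num.Theory.
Import numFieldNormedType.Exports.
Local Open Scope classical_set_scope.
Local Open Scope ring_scope.

Section alpha_p.
Context (d : measure_display) (T : measurableType d) (R : realType).
Variable mu : {measure set T -> \bar R}.

(* Elements of L_0 are given by representatives in {mfun T >-> R}: every notion
   below depends only on the mu-a.e. classes of the functions involved. *)

Definition Lambda (p : R) : set {mfun T >-> R} :=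
  [set f | forall delta : R, 0 < delta ->
    exists E : set T, [/\ measurable E, (mu E < delta%:E)%E &
      f \* \1_(~` E) \in Lfun mu p%:E]].

(* Extended-real valued: the norm is +oo when min(|f|, 1) is not in L_p. *)
Definition alpha_norm (p : R) (f : T -> R) : \bar R :=
  'N[mu]_p%:E[EFin \o (fun x => Num.min `|f x| 1)%R]%E.

Definition alpha_cvg (p : R) (f_ : nat -> T -> R) (f : T -> R) : Prop :=
  exists B : nat -> set T,
    [/\ forall n, measurable (B n),
        mu (~` B n) @[n --> \oo] --> 0%E &
        (\int[mu]_(x in B n) (`|f_ n x - f x| `^ p)%:E)%E @[n --> \oo] --> 0%E].

Definition cvg_measure_on (D : set T) (f_ : nat -> T -> R) (f : T -> R) : Prop :=
  forall delta : R, 0 < delta ->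
    mu (D `&` [set x | delta < `|f_ n x - f x|]) @[n --> \oo] --> 0%E.

Definition cvg_measure (f_ : nat -> T -> R) (f : T -> R) : Prop :=
  cvg_measure_on [set: T] f_ f.

Definition cvg_local_measure (f_ : nat -> T -> R) (f : T -> R) : Prop :=
  forall D : set T, measurable D -> (mu D < +oo)%E -> cvg_measure_on D f_ f.

Definition alpha_tight (p : R) (f_ : nat -> T -> R) : Prop :=
  forall eps : R, 0 < eps ->
    exists E : set T, [/\ measurable E, (mu E < +oo)%E &
      (ereal_sup (range (fun n => alpha_norm p (f_ n \* \1_(~` E))%R)) < eps%:E)%E].

(* With D = setT this says that mu is semifinite. *)
Definition semifinite_on (D : set T) : Prop :=
  forall A : set T, measurable A -> A `<=` D -> mu A = +oo%E ->
    exists B : set T, [/\ measurable B, B `<=` A & (0 < mu B < +oo)%E].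

End alpha_p.

(* Main.v *)
(** With [J h = \int min(|h|, 1)^p], asymptotic L_p convergence of [f_n] to [f]
    means [J (f_n - f) -> 0] (take [B_n = {|f_n - f| <= 1}]), and [J] satisfies a
    triangle inequality with constant [2^p].  For the direct implication,
    Chebyshev's inequality gives convergence in measure, and tightness reduces to
    the tightness of finitely many [f_n] and of [f], whose [J] is finite.
    Conversely, outside the set [E] given by tightness the integrals over sets of
    finite measure pass to the limit [f]; once the level sets of [f] have finite
    measure, monotone convergence bounds [J f] outside [E], while local
    convergence in measure controls [f_n - f] on [E].  Finiteness of the level
    sets comes from those of [f_n] and [f_n - f] for convergence in measure, and
    from semifiniteness for local convergence. *)
Require Import Defs.
From HB Require Import structures.
From mathcomp Require Import all_boot all_order all_algebra.
From mathcomp Require Import all_classical all_reals all_analysis.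
From mathcomp Require Import measurable_realfun ring lra.
Set Implicit Arguments.
Unset Strict Implicit.
Unset Printing Implicit Defensive.
Import Order.TTheory GRing.Theory Num.Theory.
Import numFieldNormedType.Exports.
Local Open Scope classical_set_scope.
Local Open Scope ring_scope.

(** * Pointwise estimates for the truncated power [min(|a|, 1)^p] *)

Section truncated_power.
Context (R : realType).
Implicit Types (a b p : R).

Definition trunc_pow p a : R := Num.min `|a| 1 `^ p.

Let min1_ge0 a : 0 <= Num.min `|a| 1.
Proof. by rewrite le_min normr_ge0 ler01. Qed.

Lemma trunc_pow_ge0 p a : 0 <= trunc_pow p a.
Proof. exact: powR_ge0. Qed.

Lemma trunc_pow_le1 p a : 0 <= p -> trunc_pow p a <= 1.
Proof.
move=> p0; have m1 : Num.min `|a| 1 <= 1 by rewrite ge_min lexx orbT.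
have := ge0_ler_powR p0 _ _ m1; rewrite powR1; apply; rewrite nnegrE//.
Qed.

Lemma trunc_pow_le_powR p a : 0 <= p -> trunc_pow p a <= `|a| `^ p.
Proof. by move=> p0; rewrite ge0_ler_powR// ?nnegrE// ge_min lexx. Qed.

Lemma le_trunc_pow p a b : 0 <= p -> `|a| <= `|b| ->
  trunc_pow p a <= trunc_pow p b.
Proof.
by move=> p0 ab; rewrite ge0_ler_powR// ?nnegrE// le_min !ge_min ab lexx orbT.
Qed.

Lemma trunc_powE1 p a : `|a| <= 1 -> trunc_pow p a = `|a| `^ p.
Proof. by move=> a1; rewrite /trunc_pow min_l. Qed.

Lemma trunc_pow1 p a : 1 <= `|a| -> trunc_pow p a = 1.
Proof. by move=> a1; rewrite /trunc_pow min_r// powR1. Qed.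

Lemma trunc_pow0 p : p != 0 -> trunc_pow p 0 = 0.
Proof. by move=> p0; rewrite trunc_powE1 normr0 ?powR0. Qed.

Lemma trunc_pow_gt0 p a : a != 0 -> 0 < trunc_pow p a.
Proof. by move=> a0; rewrite powR_gt0// lt_min normr_gt0 a0 ltr01. Qed.

(** The truncation of [c] is at most twice the larger of the truncations of [a] and [b], and the
    power of a maximum is at most the sum of the powers; hence the constant 2^p. Leaving [c] free
    allows every arrangement of [f_n], [f] and [f_n - f]. *)
Lemma trunc_powD p a b c : 0 <= p -> `|c| <= `|a| + `|b| ->
  trunc_pow p c <= 2 `^ p * (trunc_pow p a + trunc_pow p b).
Proof.
move=> p0 cab; set M := Num.max (Num.min `|a| 1) (Num.min `|b| 1).
have M0 : 0 <= M by rewrite le_max min1_ge0.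
have : Num.min `|c| 1 <= 2 * M.
  move: cab (normr_ge0 a) (normr_ge0 b); rewrite /M.
  move: `|c| `|a| `|b| => x y z.
  by rewrite /Num.max /Num.min; repeat case: ifPn; rewrite -?leNgt => *; lra.
move=> aM; apply: le_trans (ge0_ler_powR p0 _ _ aM) _.
- by rewrite nnegrE.
- by rewrite nnegrE mulr_ge0.
rewrite powRM// ler_pM2l ?powR_gt0//.
rewrite /M /Num.max; case: ifPn => _.
- by rewrite lerDr trunc_pow_ge0.
- by rewrite lerDl trunc_pow_ge0.
Qed.

Lemma measurable_trunc_pow p : measurable_fun setT (trunc_pow p).
Proof.
have mm : measurable_fun setT (fun a : R => Num.min `|a| 1).
  exact: (measurable_minr (@normr_measurable _ setT) (measurable_cst _)).
exact: measurableT_comp (measurable_powR p) mm.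
Qed.

End truncated_power.

(** Taking [e = 1] makes the terms eventually finite, which reduces the claim to the real epsilon
    criterion. *)
Lemma cvge0_le {R : realType} (u : nat -> \bar R) : (forall n, 0 <= u n)%E ->
  u n @[n --> \oo] --> 0%E <->
  (forall e : R, 0 < e -> \forall n \near \oo, (u n <= e%:E)%E).
Proof.
move=> u0; split=> [uu e e0|H].
  have ue := uu _ (@nbhs_open_ereal_lt _ 0 (fun=> e) e0).
  by near=> n; apply/ltW; near: n; exact: ue.
apply/fine_cvgP; split.
  apply: filterS (H 1 ltr01) => n un.
  by rewrite ge0_fin_numE// (le_lt_trans un)// ltry.
apply/cvgr0Pnorm_le => e e0; apply: filterS (H e e0) => n un /=.
rewrite ger0_norm ?fine_ge0// -lee_fin fineK//.
by rewrite ge0_fin_numE// (le_lt_trans un)// ltry.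
Unshelve. all: by end_near.
Qed.

(** * The functional [trunc_int], and both sides of the equivalence expressed through it *)

Section trunc_int.
Context (d : measure_display) (T : measurableType d) (R : realType).
Variables (mu : {measure set T -> \bar R}) (p : R).
Hypothesis p_gt0 : 0 < p.
Implicit Types (S E : set T) (f g h : T -> R).
Local Open Scope ereal_scope.

Let p_ge0 : (0 <= p)%R := ltW p_gt0.

(** This is the [p]-th power of the [alpha_norm] of [h] restricted to [S]. Dropping the root makes
    it additive in [S]. *)
Definition trunc_int S h := \int[mu]_(x in S) (trunc_pow p (h x))%:E.

Lemma measurable_trunc S h : measurable_fun setT h ->
  measurable_fun S (fun x => (trunc_pow p (h x))%:E).
Proof.
move=> mh; apply: measurable_funTS; apply/measurable_EFinP.
exact: measurableT_comp (measurable_trunc_pow p) mh.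
Qed.

Lemma trunc_int_ge0 S h : 0 <= trunc_int S h.
Proof. by apply: integral_ge0 => x _; rewrite lee_fin trunc_pow_ge0. Qed.

Lemma trunc_int_subset A B h : measurable A -> measurable B ->
  measurable_fun setT h -> A `<=` B -> trunc_int A h <= trunc_int B h.
Proof.
move=> mA mB mh AB; apply: ge0_subset_integral => //.
  exact: measurable_trunc.
by move=> x _; rewrite lee_fin trunc_pow_ge0.
Qed.

Lemma trunc_intD S f g h : measurable S ->
  measurable_fun setT f -> measurable_fun setT g -> measurable_fun setT h ->
  (forall x, `|h x| <= `|f x| + `|g x|)%R ->
  trunc_int S h <= (2 `^ p)%:E * (trunc_int S f + trunc_int S g).
Proof.
move=> mS mf mg mh hfg.
have mfS := @measurable_trunc S _ mf; have mgS := @measurable_trunc S _ mg.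
have mhS := @measurable_trunc S _ mh.
rewrite -ge0_integralD//; try by move=> x _; rewrite lee_fin trunc_pow_ge0.
rewrite -ge0_integralZl//; first last.
- by move=> x _; rewrite adde_ge0// lee_fin trunc_pow_ge0.
- exact: emeasurable_funD.
apply: ge0_le_integral => //.
- by move=> x _; rewrite lee_fin trunc_pow_ge0.
- by apply: emeasurable_funM => //; exact: emeasurable_funD.
- by move=> x _; rewrite -EFinD -EFinM lee_fin trunc_powD.
Qed.

Lemma trunc_int_le_powR S h : measurable S -> measurable_fun setT h ->
  trunc_int S h <= \int[mu]_(x in S) (`|h x| `^ p)%:E.
Proof.
move=> mS mh; apply: ge0_le_integral => //.
- by move=> x _; rewrite lee_fin trunc_pow_ge0.
- exact: measurable_trunc.
- apply: measurable_funTS; apply/measurable_EFinP.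
  apply: measurableT_comp (measurable_powR p) _.
  exact: measurableT_comp.
- by move=> x _; rewrite lee_fin trunc_pow_le_powR.
Qed.

Lemma trunc_int_le S h (c : R) : measurable S -> measurable_fun setT h ->
  (0 <= c)%R -> (forall x, S x -> trunc_pow p (h x) <= c)%R ->
  trunc_int S h <= c%:E * mu S.
Proof.
move=> mS mh c0 hc; rewrite -integral_cst//; apply: ge0_le_integral => //.
- by move=> x _; rewrite lee_fin trunc_pow_ge0.
- exact: measurable_trunc.
Qed.

Lemma trunc_int_le_measure S h : measurable S -> measurable_fun setT h ->
  trunc_int S h <= mu S.
Proof.
move=> mS mh; rewrite -[leRHS]mul1e; apply: trunc_int_le => // x _.
exact: trunc_pow_le1.
Qed.

Lemma trunc_int_setIC S E h : measurable S -> measurable E ->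
  measurable_fun setT h ->
  trunc_int S h = trunc_int (S `&` E) h + trunc_int (S `&` ~` E) h.
Proof.
move=> mS mE mh; have mEC := measurableC mE.
rewrite -ge0_integral_setU//; first by rewrite -setIUr setUv setIT.
- exact: measurableI.
- exact: measurableI.
- exact: measurable_trunc.
- by move=> x _; rewrite lee_fin trunc_pow_ge0.
- by apply/disj_setPS => x [[_ ?] [_ ?]].
Qed.

Lemma measurable_lt_norm S h (c : R) : measurable S -> measurable_fun setT h ->
  measurable (S `&` [set x | c < `|h x|]%R).
Proof.
move=> mS mh; apply: measurableI => //; rewrite -[X in measurable X]setTI.
have mn : measurable_fun setT (fun x => `|h x|%R) by exact: measurableT_comp.
have -> : [set x | c < `|h x|]%R = (fun x => `|h x|%R) @^-1` `]c, +oo[%classic.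
  by apply/seteqP; split => x /=; rewrite in_itv/= andbT.
by apply: mn => //; exact: measurable_itv.
Qed.

(** Chebyshev's inequality: [trunc_pow p] is monotone in the absolute value, so the integrand is at
    least [trunc_pow p c] where [|h|] exceeds [c]. *)
Lemma trunc_int_markov S h (c : R) : measurable S -> measurable_fun setT h ->
  (0 <= c)%R ->
  (trunc_pow p c)%:E * mu (S `&` [set x | c < `|h x|]%R) <= trunc_int S h.
Proof.
move=> mS mh c0; have mSc := measurable_lt_norm c mS mh.
rewrite -integral_cst//.
apply: (@le_trans _ _ (trunc_int (S `&` [set x | c < `|h x|]%R) h)).
  apply: ge0_le_integral => //.
  - by move=> x _; rewrite lee_fin trunc_pow_ge0.
  - exact: measurable_trunc.
  - by move=> x [_ /= /ltW cx]; rewrite lee_fin le_trunc_pow// ger0_norm.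
by apply: trunc_int_subset => //; exact: subIsetl.
Qed.

(** Since [trunc_pow p 0 = 0], the indicator inside the truncation amounts to restricting the domain
    of integration. *)
Lemma alpha_normE E h : measurable E ->
  alpha_norm mu p (h \* \1_E)%R = trunc_int E h `^ p^-1.
Proof.
move=> mE; rewrite /alpha_norm unlock /trunc_int [in RHS]integral_mkcond.
congr (_ `^ _); apply: eq_integral => x _ /=.
rewrite patchE indicE; case: ifPn => xE /=.
  rewrite mulr1 ger0_norm ?le_min ?normr_ge0 ?ler01//.
by rewrite mulr0 normr0 min_l// normr0 powR0// gt_eqF.
Qed.

Lemma alpha_cvgP (f_ : nat -> T -> R) (f : T -> R) :
  (forall n, measurable_fun setT (f_ n)) -> measurable_fun setT f ->
  alpha_cvg mu p f_ f <->
  trunc_int setT (f_ n \- f)%R @[n --> \oo] --> 0.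
Proof.
move=> mf_ mf; have mD n : measurable_fun setT (f_ n \- f)%R.
  exact: measurable_funB.
split=> [[B [mB muB intB]]|Dcvg].
  (* On [B n] the truncated power is at most the full power; on the complement it is at most 1. *)
  have ub : (\int[mu]_(x in B n) (`|f_ n x - f x| `^ p)%:E + mu (~` B n))
      @[n --> \oo] --> 0 by rewrite -[0]adde0; exact: cvgeD.
  apply: squeeze_cvge (cvg_cst _) ub; apply: nearW => n.
  rewrite trunc_int_ge0 (@trunc_int_setIC _ (B n))// !setTI leeD//.
    exact: (@trunc_int_le_powR _ (f_ n \- f)%R).
  by apply: trunc_int_le_measure => //; exact: measurableC.
(* On this [B n] the truncation is inactive, and Chebyshev's inequality at level 1 bounds the
   measure of its complement. *)
pose B n := ~` (setT `&` [set x | 1 < `|(f_ n \- f)%R x|]%R).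
have mB n : measurable (B n) by apply/measurableC/measurable_lt_norm.
exists B; split => //.
  apply: squeeze_cvge (cvg_cst _) Dcvg; apply: nearW => n.
  rewrite measure_ge0 setCK -[leLHS]mul1e.
  have := @trunc_int_markov setT (f_ n \- f)%R 1 measurableT (mD n) ler01.
  by rewrite trunc_pow1// normr1.
apply: squeeze_cvge (cvg_cst _) Dcvg; apply: nearW => n.
rewrite integral_ge0/=; last by move=> x _; rewrite lee_fin powR_ge0.
apply: (@le_trans _ _ (trunc_int (B n) (f_ n \- f)%R)); last first.
  by apply: trunc_int_subset.
rewrite le_eqVlt; apply/orP; left; apply/eqP/eq_integral => x.
rewrite inE /B setTI /= => /negP; rewrite -leNgt => le1.
by rewrite trunc_powE1.
Qed.

(** Raising to the power [p] removes the root from the norm, and uniform bounds replace the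
    supremum. *)
Lemma alpha_tightP (f_ : nat -> T -> R) :
  alpha_tight mu p f_ <->
  forall e : R, (0 < e)%R -> exists E, [/\ measurable E, mu E < +oo &
    forall n, trunc_int (~` E) (f_ n) <= e%:E].
Proof.
have pNp (c : R) : (0 < c)%R -> ((c `^ p^-1) `^ p = c)%R.
  by move=> c0; rewrite -powRrM mulVf ?gt_eqF// powRr1 ?ltW.
have le_poweR (x y : \bar R) r : (0 <= r)%R -> 0 <= x -> x <= y ->
    x `^ r <= y `^ r.
  move=> r0 x0 xy; apply: gt0_ler_poweR => //; rewrite in_itv/= leey andbT//.
  exact: le_trans xy.
split=> H e e0.
  have [|E [mE muE Ee]] := H (e `^ p^-1)%R; first exact: powR_gt0.
  exists E; split => // n.
  have : alpha_norm mu p (f_ n \* \1_(~` E))%R <= (e `^ p^-1)%:E.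
    by apply: le_trans (ltW Ee); apply: ereal_sup_ubound; exists n.
  rewrite alpha_normE; last exact: measurableC.
  move=> /(le_poweR _ _ _ p_ge0 (poweR_ge0 _ _)).
  by rewrite -poweRrM mulVf ?gt_eqF// poweRe1 ?trunc_int_ge0// poweR_EFin pNp.
(* Aiming at [e / 2] turns the non-strict bounds into the strict bound on the supremum. *)
have e20 : (0 < e / 2)%R by rewrite divr_gt0.
have [|E [mE muE Ee]] := H ((e / 2) `^ p)%R; first exact: powR_gt0.
exists E; split => //; apply: (@le_lt_trans _ _ (e / 2)%:E); last first.
  by rewrite lte_fin; lra.
apply: ge_ereal_sup => _ [n _ <-].
rewrite alpha_normE; last exact: measurableC.
have pV : (0 <= p^-1)%R by rewrite invr_ge0.
apply: le_trans (le_poweR _ _ _ pV (trunc_int_ge0 _ _) (Ee n)) _.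
by rewrite poweR_EFin -powRrM mulfV ?gt_eqF// powRr1// ltW.
Qed.

End trunc_int.

(** * Semifiniteness yields subsets of arbitrarily large finite measure *)

Section semifinite.
Context (d : measure_display) (T : measurableType d) (R : realType).
Variable mu : {measure set T -> \bar R}.
Local Open Scope ereal_scope.

(* Exhaustion: if the subsets of finite measure had bounded measure, a countable
   union of almost maximal ones would be maximal, and semifiniteness of its
   complement in A would contradict the maximality. *)
Lemma semifinite_on_infty (D A : set T) (M : R) : semifinite_on mu D ->
  measurable A -> A `<=` D -> mu A = +oo ->
  exists B, [/\ measurable B, B `<=` A & M%:E < mu B < +oo].
Proof.
move=> sfD mA AD muA; apply: contrapT => noB.
pose fam := [set B | [/\ measurable B, B `<=` A & mu B < +oo]].
have famM B : fam B -> mu B <= M%:E.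
  move=> [mB BA muB]; rewrite leNgt; apply/negP => MB.
  by apply: noB; exists B; rewrite MB muB.
have fam0 : fam set0 by split => //; rewrite measure0.
have famU B C : fam B -> fam C -> fam (B `|` C).
  move=> [mB BA muB] [mC CA muC]; split; first exact: measurableU.
    by rewrite subUset.
  by rewrite (le_lt_trans (measureU2 _ mB mC))// lte_add_pinfty.
pose s := ereal_sup [set mu B | B in fam].
have fams B : fam B -> mu B <= s.
  by move=> famB; apply: ereal_sup_ubound; exists B.
have s_fin : s \is a fin_num.
  rewrite fin_real// (lt_le_trans (ltNyr 0)) ?(le_trans _ (fams _ fam0))//=.
  by apply: le_lt_trans (ltry M); apply: ge_ereal_sup => _ [B /famM ? <-].
have /choice[B famB] (n : nat) : exists B, fam B /\ s - n.+1%:R^-1%:E < mu B.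
  have n0 : (0 < n.+1%:R^-1 :> R)%R by rewrite invr_gt0.
  have [_ [B famB <-] sB] := ub_ereal_sup_adherent n0 s_fin.
  by exists B.
(* The partial unions stay in [fam], so their measures, and by continuity from below that of the
   full union, are at most [s]. *)
pose C n := \big[setU/set0]_(i < n.+1) B i.
have famC n : fam (C n).
  rewrite /C; elim: n.+1 => [|k IHk]; first by rewrite big_ord0.
  by rewrite big_ord_recr; apply: famU => //; exact: (famB k).1.
have mUB : measurable (\bigcup_n B n).
  by apply: bigcup_measurable => n _; have [[]] := famB n.
have cvgC : mu (C n) @[n --> \oo] --> mu (\bigcup_n B n).
  rewrite -bigcup_bigsetU_bigcup; apply: nondecreasing_cvg_mu.
  - by move=> n; have [] := famC n.
  - by rewrite bigcup_bigsetU_bigcup.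
  - move=> m n mn; apply/subsetPset/subset_bigsetU => //.
have UBs : mu (\bigcup_n B n) <= s.
  by apply: cvge_to_le cvgC _; apply: nearW => n; exact: fams.
have famUB : fam (\bigcup_n B n).
  split => //; first by apply: bigcup_sub => n _; have [[]] := famB n.
  by rewrite (le_lt_trans UBs)// ltey_eq s_fin.
have [mAB ABA] : measurable (A `\` \bigcup_n B n) /\ A `\` \bigcup_n B n `<=` A.
  by split; [exact: measurableD|exact: subDsetl].
have muAB : mu (A `\` \bigcup_n B n) = +oo.
  apply/eqP; rewrite -leye_eq leNgt; apply/negP => muAB.
  have := measureU2 mu mUB mAB; rewrite setDUK; last by case: famUB.
  apply/negP; rewrite -ltNge [ltRHS]muA lte_add_pinfty//.
  by case: famUB.
have [B' [mB' B'A /andP[muB'0 muB'y]]] :=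
  sfD _ mAB (subset_trans ABA AD) muAB.
have famUB' : fam (\bigcup_n B n `|` B').
  by apply: famU => //; split => //; exact: subset_trans B'A ABA.
have := fams _ famUB'; rewrite measureU//; last first.
  by apply/seteqP; split => x // [? /B'A[]].
apply/negP; rewrite -ltNge.
(* Each [B n] misses [s] by less than 1/(n+1), so the union attains [s]; adding [B'], of positive
   measure, would then exceed [s]. *)
have sUB : s <= mu (\bigcup_n B n).
  apply/lee_addgt0Pr => e e0.
  have [n ne] := ltr_add_invr e0; rewrite add0r in ne.
  rewrite -leeBlDr//; apply: (@le_trans _ _ (s - n.+1%:R^-1%:E)).
    by rewrite leeB// lee_fin ltW.
  rewrite (le_trans (ltW (famB n).2))// le_measure ?inE//.
    by have [[]] := famB n.
  exact: bigcup_sup.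
by rewrite (le_lt_trans sUB)// lteDl// fin_real//
  (lt_le_trans (ltNyr 0))//=; case: famUB.
Qed.

End semifinite.

(** * Convergence of [J (f_n - f)] to 0 compared with convergence in measure and tightness *)

Section alpha_convergence.
Context (d : measure_display) (T : measurableType d) (R : realType).
Variables (mu : {measure set T -> \bar R}) (p : R).
Hypothesis p_gt0 : 0 < p.
Implicit Types (S E : set T) (f g h : T -> R).
Local Open Scope ereal_scope.

Let p_ge0 : (0 <= p)%R := ltW p_gt0.
Local Notation J := (trunc_int mu p).

Let C : R := (2 `^ p)%R.
Let C_gt0 : (0 < C)%R. Proof. exact: powR_gt0. Qed.

(** The sets increase to the part of [S] where [h] is nonzero, and the integrand vanishes on the
    rest; monotone convergence concludes. *)
Lemma trunc_int_cvg S h : measurable S -> measurable_fun setT h ->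
  J (S `&` [set x | n.+1%:R^-1 < `|h x|]%R) h @[n --> \oo] --> J S h.
Proof.
move=> mS mh; pose F n := S `&` [set x | n.+1%:R^-1 < `|h x|]%R.
have mF n : measurable (F n) by exact: measurable_lt_norm.
have mUF : measurable (\bigcup_n F n) by exact: bigcup_measurable.
have UFE : \bigcup_n F n = S `&` [set x | h x != 0%R].
  apply/seteqP; split => x /=.
    by move=> [n _ [Sx /= nx]]; split => //; rewrite -normr_gt0 (lt_trans _ nx).
  move=> [Sx hx]; have hx0 : (0 < `|h x|)%R by rewrite normr_gt0.
  by have [n] := ltr_add_invr hx0; rewrite add0r => ?; exists n.
have -> : J S h = J (\bigcup_n F n) h.
  rewrite (@trunc_int_setIC _ _ _ _ _ _ (\bigcup_n F n))//.
  rewrite [X in _ + X](_ : _ = 0) ?adde0.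
    by congr (J _ h); rewrite UFE setIA setIid.
  apply: integral0_eq => x [Sx]; rewrite UFE /= => nSx.
  have -> : h x = 0%R by apply/eqP/negPn/negP => hx; apply: nSx.
  by rewrite trunc_pow0// gt_eqF.
apply: ge0_nondecreasing_set_cvg_integral => //.
- move=> m n mn; apply/subsetPset => x [Sx /= mx]; split => //=.
  by rewrite (le_lt_trans _ mx)// lef_pV2 ?posrE// ler_nat.
- by move=> n; exact: measurable_trunc.
- by move=> n x _; rewrite lee_fin trunc_pow_ge0.
Qed.

Lemma trunc_int_lty_markov h (c : R) : measurable_fun setT h -> (0 < c)%R ->
  J setT h < +oo -> mu [set x | c < `|h x|]%R < +oo.
Proof.
move=> mh c0 Jh; have tc0 : (0 < trunc_pow p c)%R.
  by rewrite trunc_pow_gt0 ?gt_eqF.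
rewrite ltNge; apply/negP; rewrite leye_eq => /eqP muy.
have := trunc_int_markov mu p_gt0 measurableT mh (ltW c0).
by rewrite setTI muy gt0_muley ?lte_fin// leNgt Jh.
Qed.

(** A level set [{|h| > 1/(n+1)}] serves as [E]: its measure is finite by Chebyshev's inequality,
    and for a suitable [n] it carries all of [J] up to [e]. *)
Lemma trunc_int_tight h (e : R) : measurable_fun setT h -> J setT h < +oo ->
  (0 < e)%R -> exists E, [/\ measurable E, mu E < +oo & J (~` E) h <= e%:E].
Proof.
move=> mh Jh e0; have Jfin A : measurable A -> J A h \is a fin_num.
  move=> mA; rewrite ge0_fin_numE ?trunc_int_ge0// (le_lt_trans _ Jh)//.
  exact: trunc_int_subset.
pose F n := [set x | n.+1%:R^-1 < `|h x|]%R.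
have mF n : measurable (F n).
  by have := measurable_lt_norm n.+1%:R^-1 measurableT mh; rewrite setTI.
have Jlt : (fine (J setT h) - e < fine (J setT h))%R by lra.
have := trunc_int_cvg measurableT mh; rewrite -(fineK (Jfin _ measurableT)).
move=> /(_ _ (nbhs_open_ereal_gt (f := fun r => r - e)%R Jlt)).
move=> [n _ /(_ n (leqnn n)) /= /ltW nJ].
exists (F n); split => //; first exact: trunc_int_lty_markov.
move: nJ; rewrite EFinB fineK; last exact: Jfin.
rewrite (@trunc_int_setIC _ _ _ _ _ setT (F n))// !setTI leeBlDr//.
by rewrite leeD2lE//; exact: Jfin.
Qed.

Lemma trunc_int_tight_seq (h_ : nat -> T -> R) (e : R) (N : nat) :
  (forall n, measurable_fun setT (h_ n)) -> (forall n, J setT (h_ n) < +oo) ->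
  (0 < e)%R -> exists E, [/\ measurable E, mu E < +oo &
    forall n, (n < N)%N -> J (~` E) (h_ n) <= e%:E].
Proof.
move=> mh Jh e0; elim: N => [|N [E [mE muE IH]]].
  by exists set0; rewrite measure0.
have [F [mF muF JF]] := trunc_int_tight (mh N) (Jh N) e0.
exists (E `|` F); split; first exact: measurableU.
  by rewrite (le_lt_trans (measureU2 _ mE mF))// lte_add_pinfty.
have mEF : measurable (~` (E `|` F)) by apply/measurableC/measurableU.
move=> n; rewrite ltnS leq_eqVlt => /predU1P[->|nN].
  apply: le_trans JF; apply: trunc_int_subset => //; first exact: measurableC.
  by apply: subsetC; exact: subsetUr.
apply: le_trans (IH n nN); apply: trunc_int_subset => //.
  exact: measurableC.
by apply: subsetC; exact: subsetUl.
Qed.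

(** Split along the set [E] given by [delta = 1]: on [E] the integral is at most [mu E], and off [E]
    it is at most the [p]-th power of a finite L_p norm. *)
Lemma Lambda_trunc_int_lty (f : {mfun T >-> R}) :
  Lambda mu p f -> J setT f < +oo.
Proof.
move=> /(_ 1%R ltr01)[E [mE muE /andP[]]]; rewrite !inE /= => mg.
rewrite /finite_norm => Ng.
have mEC := measurableC mE; have mf : measurable_fun setT f by [].
rewrite (@trunc_int_setIC _ _ _ _ _ _ E)// !setTI lte_add_pinfty//.
  apply: le_lt_trans (trunc_int_le_measure mu p_gt0 mE mf) _.
  exact: lt_trans muE (ltry _).
have -> : J (~` E) f = J (~` E) (f \* \1_(~` E))%R.
  by apply: eq_integral => x xE; rewrite /= indicE xE mulr1.
apply: (@le_lt_trans _ _ (J setT (f \* \1_(~` E))%R)).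
  by apply: trunc_int_subset.
apply: le_lt_trans (trunc_int_le_powR mu p_gt0 measurableT mg) _.
have := poweR_lty p Ng; rewrite poweR_Lnorm ?gt_eqF//.
Qed.

Lemma trunc_int_sub_cvg_measure (f_ : nat -> T -> R) (f : T -> R) :
  (forall n, measurable_fun setT (f_ n)) -> measurable_fun setT f ->
  J setT (f_ n \- f)%R @[n --> \oo] --> 0 -> cvg_measure mu f_ f.
Proof.
move=> mf_ mf Jcvg c c0; have mD n : measurable_fun setT (f_ n \- f)%R.
  exact: measurable_funB.
have tc0 : (0 < trunc_pow p c)%R by rewrite trunc_pow_gt0 ?gt_eqF.
apply/cvge0_le => // e e0.
have ec0 : (0 < trunc_pow p c * e)%R by rewrite mulr_gt0.
have [Jnear _] := cvge0_le (fun n => trunc_int_ge0 mu p setT (f_ n \- f)%R).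
apply: filterS (Jnear Jcvg _ ec0) => n Jn.
rewrite -(@lee_pmul2l _ (trunc_pow p c)%:E) ?lte_fin//.
rewrite -EFinM; apply: le_trans Jn.
exact: (trunc_int_markov mu p_gt0 measurableT (mD n) (ltW c0)).
Qed.

Lemma cvg_measure_local (f_ : nat -> T -> R) (f : T -> R) :
  (forall n, measurable_fun setT (f_ n)) -> measurable_fun setT f ->
  cvg_measure mu f_ f -> cvg_local_measure mu f_ f.
Proof.
move=> mf_ mf fcvg S mS _ c c0; have mD n : measurable_fun setT (f_ n \- f)%R.
  exact: measurable_funB.
apply: squeeze_cvge (cvg_cst _) (fcvg c c0); apply: nearW => n.
rewrite measure_ge0 le_measure ?inE//.
- exact: (measurable_lt_norm c mS (mD n)).
- exact: (measurable_lt_norm c measurableT (mD n)).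
- exact: setSI.
Qed.

Lemma trunc_int_sub_cvg_tight (f_ : nat -> T -> R) (f : T -> R) :
  (forall n, measurable_fun setT (f_ n)) -> measurable_fun setT f ->
  (forall n, J setT (f_ n) < +oo) ->
  J setT (f_ n \- f)%R @[n --> \oo] --> 0 -> alpha_tight mu p f_.
Proof.
move=> mf_ mf Jf_ Jcvg; have mD n : measurable_fun setT (f_ n \- f)%R.
  exact: measurable_funB.
have [/(_ Jcvg) Jnear _] :=
  cvge0_le (fun n => trunc_int_ge0 mu p setT (f_ n \- f)%R).
apply/alpha_tightP => // e e0.
(* Write [f = f_n - (f_n - f)] for one [n] with [J (f_n - f) <= 1]. *)
have Jf : J setT f < +oo.
  have [n _ /(_ n (leqnn n)) J1] := Jnear 1%R ltr01.
  apply: le_lt_trans (trunc_intD mu p_gt0 measurableT (mf_ n) (mD n) mf _) _.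
    move=> x; rewrite /= -[X in (`|X| <= _)%R](subKr (f_ n x)).
    exact: ler_normB.
  by rewrite lte_mul_pinfty// lte_add_pinfty// (le_lt_trans J1)// ltry.
(* Chosen so that [C * (e' + e') = e], for the triangle inequality applied to [f + (f_n - f)]. *)
pose e' := (e / (2 * C))%R; have e'0 : (0 < e')%R.
  by rewrite divr_gt0// mulr_gt0.
have [N _ JN] := Jnear e' e'0.
(* Putting [f] in front of the sequence lets one set [E] serve [f] and the first [N] functions,
   whence the bound [N.+1]. The minimum gives [e] for those functions and [e'] for [f]. *)
pose h_ n := if n is m.+1 then f_ m else f.
have [|||E [mE muE JE]] := @trunc_int_tight_seq h_ (Num.min e e') N.+1.
- by case.
- by case.
- by rewrite lt_min e0.
exists E; split => // n; have mEC := measurableC mE.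
have [nN|Nn] := ltnP n N.
  by apply: le_trans (JE n.+1 _) _; rewrite ?ltnS// lee_fin ge_min lexx.
apply: le_trans (trunc_intD mu p_gt0 mEC mf (mD n) (mf_ n) _) _.
  move=> x; rewrite /= -[X in (`|X| <= _)%R](subrKC (f x)).
  exact: ler_normD.
apply: (@le_trans _ _ (C%:E * (e'%:E + e'%:E))).
  rewrite lee_pmul2l ?lte_fin// leeD//.
    by apply: le_trans (JE 0%N _) _ => //; rewrite lee_fin ge_min lexx orbT.
  by apply: le_trans (JN n Nn); exact: trunc_int_subset.
by rewrite -EFinD -EFinM lee_fin le_eqVlt; apply/orP; left; apply/eqP;
  rewrite /e'; field; rewrite gt_eqF.
Qed.

(** * From local convergence in measure and tightness back to [J (f_n - f)] *)

Lemma trunc_int_sub_cvg_local (f_ : nat -> T -> R) (f : T -> R) S :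
  (forall n, measurable_fun setT (f_ n)) -> measurable_fun setT f ->
  cvg_local_measure mu f_ f -> measurable S -> mu S < +oo ->
  J S (f_ n \- f)%R @[n --> \oo] --> 0.
Proof.
move=> mf_ mf fcvg mS muS; have mD n : measurable_fun setT (f_ n \- f)%R.
  exact: measurable_funB.
apply/cvge0_le => [n|e e0]; first exact: trunc_int_ge0.
have muSfin : mu S \is a fin_num by rewrite ge0_fin_numE.
have muS0 : (0 <= fine (mu S))%R by exact: fine_ge0.
(* This makes [c * mu S <= e / 2]; the added 1 keeps the denominator positive when [mu S = 0]. *)
pose c := (e / (2 * (fine (mu S) + 1)))%R.
have c0 : (0 < c)%R by rewrite divr_gt0// mulr_gt0// ltr_wpDl.
(* Where [|f_n - f| <= del] the integrand is at most [del^p = c]; the remaining part of [S]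
   eventually has measure at most [e / 2]. *)
pose del := (c `^ p^-1)%R; have del0 : (0 < del)%R by exact: powR_gt0.
have tdel : (trunc_pow p del <= c)%R.
  rewrite (le_trans (trunc_pow_le_powR _ p_ge0))// (ger0_norm (ltW del0)).
  by rewrite -powRrM mulVf ?gt_eqF// powRr1// ltW.
have e20 : (0 < e / 2)%R by rewrite divr_gt0.
pose B n := [set x | del < `|(f_ n \- f)%R x|]%R.
have mB n : measurable (B n).
  by have := measurable_lt_norm del measurableT (mD n); rewrite setTI.
have [munear _] := cvge0_le (fun n => measure_ge0 mu (S `&` B n)).
apply: filterS (munear (fcvg S mS muS del del0) _ e20) => n muB.
rewrite (@trunc_int_setIC _ _ _ _ _ _ (B n))//.
rewrite [e%:E](_ : _ = (e / 2)%:E + (e / 2)%:E); last by rewrite -EFinD -splitr.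
have mSB : measurable (S `&` ~` B n) by apply/measurableI/measurableC.
apply: leeD.
  apply: le_trans (trunc_int_le_measure mu p_gt0 _ (mD n)) muB.
  exact: measurableI.
apply: le_trans (@trunc_int_le _ _ _ mu p _ _ c mSB (mD n) (ltW c0) _) _.
  move=> x [_ /negP]; rewrite -leNgt => xdel; apply: le_trans tdel.
  by apply: le_trunc_pow => //; rewrite [leRHS]ger0_norm// ltW.
apply: (@le_trans _ _ (c%:E * mu S)).
  by rewrite lee_pmul2l ?lte_fin// le_measure ?inE//; exact: subIsetl.
rewrite -(fineK muSfin) -EFinM lee_fin /c.
rewrite mulrAC ler_pdivrMr ?mulr_gt0 ?ltr_wpDl// mulrA divfK ?gt_eqF//.
by rewrite ler_pM2l// lerDl.
Qed.

(** A substitute for Fatou's lemma, losing a factor [C]: apply the triangle inequality to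
    [f = f_n - (f_n - f)] with [n] so large that the last term is negligible on [S]. *)
Lemma trunc_int_le_lim (f_ : nat -> T -> R) (f : T -> R) S (c : R) :
  (forall n, measurable_fun setT (f_ n)) -> measurable_fun setT f ->
  cvg_local_measure mu f_ f -> measurable S -> mu S < +oo ->
  (forall n, J S (f_ n) <= c%:E) -> J S f <= (C * c)%:E.
Proof.
move=> mf_ mf fcvg mS muS Jc; have mD n : measurable_fun setT (f_ n \- f)%R.
  exact: measurable_funB.
have [Jnear _] := cvge0_le (fun n => trunc_int_ge0 mu p S (f_ n \- f)%R).
apply/lee_addgt0Pr => e e0; have eC : (0 < e / C)%R by rewrite divr_gt0.
have [n _ /(_ n (leqnn n)) Jn] :=
  Jnear (trunc_int_sub_cvg_local mf_ mf fcvg mS muS) _ eC.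
apply: le_trans (trunc_intD mu p_gt0 mS (mf_ n) (mD n) mf _) _.
  move=> x; rewrite /= -[X in (`|X| <= _)%R](subKr (f_ n x)).
  exact: ler_normB.
apply: (@le_trans _ _ (C%:E * (c%:E + (e / C)%:E))).
  by rewrite lee_pmul2l ?lte_fin// leeD.
rewrite -!EFinD -EFinM lee_fin le_eqVlt; apply/orP; left; apply/eqP.
by field; rewrite gt_eqF.
Qed.

(** Common core of both converse implications; finiteness of the level sets of [f] is left as a
    hypothesis because its proof depends on the mode of convergence. *)
Lemma cvg_local_tight_trunc_int_sub (f_ : nat -> T -> R) (f : T -> R) :
  (forall n, measurable_fun setT (f_ n)) -> measurable_fun setT f ->
  (forall c : R, (0 < c)%R -> mu [set x | c < `|f x|]%R < +oo) ->
  cvg_local_measure mu f_ f -> alpha_tight mu p f_ ->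
  J setT (f_ n \- f)%R @[n --> \oo] --> 0.
Proof.
move=> mf_ mf muf fcvg /(alpha_tightP _ p_gt0) ft.
have mD n : measurable_fun setT (f_ n \- f)%R by exact: measurable_funB.
apply/cvge0_le => [n|e e0]; first exact: trunc_int_ge0.
have e20 : (0 < e / 2)%R by rewrite divr_gt0.
have C1 : (0 < 1 + C)%R by rewrite addr_gt0.
(* Solves [C * (c + C * c) = e / 2], where [c] bounds [J] of [f_n] and [C * c] bounds [J] of [f] off
   [E]. *)
pose c := (e / 2 / (C * (1 + C)))%R; have c0 : (0 < c)%R.
  by rewrite divr_gt0// mulr_gt0.
have [E [mE muE JE]] := ft c c0; have mEC := measurableC mE.
(* The complement of [E] may have infinite measure, so the bound is first proved on its
   intersections with level sets of [f], then passed to the limit. *)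
have JEf : J (~` E) f <= (C * c)%:E.
  apply: cvge_to_le (trunc_int_cvg mEC mf) _; apply: nearW => n.
  have mS := measurable_lt_norm n.+1%:R^-1 mEC mf.
  apply: (trunc_int_le_lim mf_ mf fcvg mS).
    apply: le_lt_trans (muf n.+1%:R^-1%R _) => //; rewrite le_measure ?inE//.
      by have := measurable_lt_norm n.+1%:R^-1 measurableT mf; rewrite setTI.
  by move=> k; apply: le_trans (JE k); exact: trunc_int_subset.
have [Jnear _] := cvge0_le (fun n => trunc_int_ge0 mu p E (f_ n \- f)%R).
have JE0 := trunc_int_sub_cvg_local mf_ mf fcvg mE muE.
apply: filterS (Jnear JE0 _ e20) => n Jn.
rewrite (@trunc_int_setIC _ _ _ _ _ _ E)// !setTI.
rewrite [e%:E](_ : _ = (e / 2)%:E + (e / 2)%:E); last by rewrite -EFinD -splitr.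
apply: leeD => //.
apply: le_trans (trunc_intD mu p_gt0 mEC (mf_ n) mf (mD n) _) _.
  by move=> x; exact: ler_normB.
apply: (@le_trans _ _ (C%:E * (c%:E + (C * c)%:E))).
  by rewrite lee_pmul2l ?lte_fin// leeD.
rewrite -EFinD -EFinM lee_fin le_eqVlt; apply/orP; left; apply/eqP.
by rewrite /c; field; rewrite !gt_eqF.
Qed.

(** If [|f| > c] then [|f_n| > c / 2] or [|f_n - f| > c / 2]; the first set has finite measure by
    Chebyshev's inequality, the second has measure at most 1 for a suitable [n]. *)
Lemma cvg_measure_level_lty (f_ : nat -> T -> R) (f : T -> R) :
  (forall n, measurable_fun setT (f_ n)) -> measurable_fun setT f ->
  (forall n, J setT (f_ n) < +oo) -> cvg_measure mu f_ f ->
  forall c : R, (0 < c)%R -> mu [set x | c < `|f x|]%R < +oo.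
Proof.
move=> mf_ mf Jf_ fcvg c c0; have mD n : measurable_fun setT (f_ n \- f)%R.
  exact: measurable_funB.
have c20 : (0 < c / 2)%R by rewrite divr_gt0.
have [munear _] := cvge0_le (fun n =>
  measure_ge0 mu (setT `&` [set x | c / 2 < `|f_ n x - f x|]%R)).
have [n _ /(_ n (leqnn n)) mun] := munear (fcvg _ c20) 1%R ltr01.
have mlt h (a : R) : measurable_fun setT h -> measurable [set x | a < `|h x|]%R.
  by move=> mh; have := measurable_lt_norm a measurableT mh; rewrite setTI.
have mfn := mlt _ (c / 2)%R (mf_ n); have mDn := mlt _ (c / 2)%R (mD n).
apply: (@le_lt_trans _ _ (mu ([set x | c / 2 < `|f_ n x|]%R `|`
    [set x | c / 2 < `|(f_ n \- f)%R x|]%R))).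
  rewrite le_measure ?inE//; [exact: mlt|exact: measurableU|].
  move=> x /= cf; apply/orP; rewrite -implyNb -leNgt; apply/implyP => fn.
  have := ler_normB (f_ n x) (f_ n x - f x)%R; rewrite subKr.
  by move: cf fn; lra.
apply: le_lt_trans (measureU2 _ mfn mDn) _.
rewrite lte_add_pinfty//; first exact: trunc_int_lty_markov.
by move: mun; rewrite setTI => /le_lt_trans; apply; exact: ltry.
Qed.

Lemma semifinite_level_lty (f_ : nat -> T -> R) (f : T -> R) :
  (forall n, measurable_fun setT (f_ n)) -> measurable_fun setT f ->
  semifinite_on mu [set x | f x != 0%R] ->
  cvg_local_measure mu f_ f -> alpha_tight mu p f_ ->
  forall c : R, (0 < c)%R -> mu [set x | c < `|f x|]%R < +oo.
Proof.
move=> mf_ mf sf fcvg /(alpha_tightP _ p_gt0) /(_ 1%R ltr01).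
move=> [E [mE muE JE]] c c0.
have mEC := measurableC mE; pose L := [set x | c < `|f x|]%R.
have mL : measurable L.
  by have := measurable_lt_norm c measurableT mf; rewrite setTI.
have mELC := measurableI _ _ mEC mL.
suff muEL : mu (~` E `&` L) < +oo.
  apply: (@le_lt_trans _ _ (mu (E `|` (~` E `&` L)))).
    rewrite le_measure ?inE//; first exact: measurableU.
    by rewrite setUIr setUv setTI; exact: subsetUr.
  by rewrite (le_lt_trans (measureU2 _ mE mELC))// lte_add_pinfty.
rewrite ltNge leye_eq; apply/negP => /eqP muEL.
have tc0 : (0 < trunc_pow p c)%R by rewrite trunc_pow_gt0 ?gt_eqF.
(* The threshold contradicts [trunc_pow p c * mu B <= J B f <= C], which follows from Chebyshev's
   inequality and from tightness with bound 1. *)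
have [|B [mB BEL /andP[muB muBy]]] :=
  @semifinite_on_infty _ _ _ mu _ _ (C / trunc_pow p c) sf mELC _ muEL.
  by move=> x [_ /= cx]; rewrite -normr_gt0 (lt_trans c0).
have JBf : J B f <= (C * 1)%:E.
  apply: (trunc_int_le_lim mf_ mf fcvg mB muBy) => n.
  by apply: le_trans (JE n); apply: trunc_int_subset => // x /BEL[].
have := le_trans (trunc_int_markov mu p_gt0 mB mf (ltW c0)) JBf.
rewrite setIidl; last by move=> x /BEL[].
apply/negP; rewrite -ltNge mulr1.
have -> : C = (trunc_pow p c * (C / trunc_pow p c))%R.
  by rewrite mulrC divfK ?gt_eqF.
by rewrite EFinM lte_pmul2l ?lte_fin.
Qed.

End alpha_convergence.

(* With local convergence in measure, the implication towards alpha_cvg fails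
   when f is nonzero on an atom of infinite measure (take f_n = 0), so it is
   stated for f such that mu is semifinite on [f != 0]; that condition holds for
   every f when mu is semifinite, and for every mu when f is in Lambda mu p. *)
Theorem theorem5p4 (d : measure_display) (T : measurableType d) (R : realType)
    (mu : {measure set T -> \bar R}) (p : R) (hp : 1 <= p)
    (f_ : nat -> {mfun T >-> R}) (f : {mfun T >-> R})
    (hf_ : forall n, Lambda mu p (f_ n)) :
  (alpha_cvg mu p f_ f <-> cvg_measure mu f_ f /\ alpha_tight mu p f_) /\
  (alpha_cvg mu p f_ f -> cvg_local_measure mu f_ f /\ alpha_tight mu p f_) /\
  (semifinite_on mu [set x | f x != 0] ->
   cvg_local_measure mu f_ f /\ alpha_tight mu p f_ -> alpha_cvg mu p f_ f).
Proof.
have p0 : 0 < p by exact: lt_le_trans hp.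
have mf_ n : measurable_fun setT (f_ n) by [].
have mf : measurable_fun setT f by [].
have Jf_ n := Lambda_trunc_int_lty p0 (hf_ n).
have cvgP := alpha_cvgP mu p0 mf_ mf.
have fwd : alpha_cvg mu p f_ f -> cvg_measure mu f_ f /\ alpha_tight mu p f_.
  move=> /cvgP Jcvg; split.
    exact: (trunc_int_sub_cvg_measure p0 mf_ mf Jcvg).
  exact: (trunc_int_sub_cvg_tight p0 mf_ mf Jf_ Jcvg).
have local := cvg_measure_local mf_ mf.
split; [split => // -[fm ft]|split].
- have level := cvg_measure_level_lty p0 mf_ mf Jf_ fm.
  exact/cvgP/(cvg_local_tight_trunc_int_sub p0 mf_ mf level (local _ fm) ft).
- by move=> /fwd[fm ft]; split => //; exact: local.
- move=> sf [fl ft]; have level := semifinite_level_lty p0 mf_ mf sf fl ft.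
  exact/cvgP/(cvg_local_tight_trunc_int_sub p0 mf_ mf level fl ft).
Qed.
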